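(* Let $\mathbf{Q}$ be a real $m\times n$ matrix with orthonormal rows, $\mathbf{Q}\mathbf{Q}^T=\mathbf{I}_m$, and coherence $\mu$, and let $\mathbf{Q}\mathbf{S}$ be computed by the sampling algorithm (described in the context) with $c$ samples. Given $0<\epsilon<1$ and $0<\delta<1$, we have $$\kappa(\mathbf{Q}\mathbf{S})\leq\frac{\sqrt{1+\epsilon}}{\sqrt{1-\epsilon}}$$ with probability at least $1-\delta$, if the algorithm (i) either samples with ``nearly optimal'' probabilities $p_j^{\beta}$, where $0<\beta\leq 1$, $\sum_{j=1}^n p_j^{\beta}=1$ and $p_j^{\beta}\geq\beta\,\|Q_j\|_2^2/\|\mathbf{Q}\|_F^2$ for $1\leq j\leq n$, and $$c\geq c_0(\epsilon)\,m\,\frac{\ln(m/\delta)}{\beta\,\epsilon^2},$$ (ii) or samples with uniform probabilities $p_j=1/n$, $1\leq j\leq n$, and $$c\geq c_0(\epsilon)\,n\,\mu\,\frac{\ln(m/\delta)}{\epsilon^2}.$$ Here $c_0(\epsilon)\equiv 2+\tfrac{2}{3}\epsilon$.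
   Context: $Q_1,\ldots,Q_n$ are the columns of $\mathbf{Q}$; the coherence of $\mathbf{Q}$ is $\mu\equiv\max_{1\leq j\leq n}\|Q_j\|_2^2$. $\sigma_1(\mathbf{Q}\mathbf{S})$ and $\sigma_m(\mathbf{Q}\mathbf{S})$ denote the largest and $m$-th largest singular values of the $m\times c$ matrix $\mathbf{Q}\mathbf{S}$, i.e. the square roots of the largest and smallest eigenvalues of $(\mathbf{Q}\mathbf{S})(\mathbf{Q}\mathbf{S})^T$. The two-norm condition number with respect to left inversion is $\kappa(\mathbf{Q}\mathbf{S})\equiv\sigma_1(\mathbf{Q}\mathbf{S})/\sigma_m(\mathbf{Q}\mathbf{S})$, defined when $\mathbf{Q}\mathbf{S}$ has full row rank (a bound on $\kappa(\mathbf{Q}\mathbf{S})$ is understood to include $\sigma_m(\mathbf{Q}\mathbf{S})>0$). $\|\cdot\|_2$ is the two-norm and $\|\cdot\|_F$ the Frobenius norm. Sampling algorithm: given $\mathbf{Q}$, a number of samples $1\leq c\leq n$ and probabilities $p_j\geq 0$ with $\sum_{j=1}^n p_j=1$, sample indices $t_1,\ldots,t_c$ from $\{1,\ldots,n\}$ independently and with replacement, with $\mathbb{P}[t_j=i]=p_i$; let $\mathbf{S}$ be the $n\times c$ matrix with columns $e_{t_j}/\sqrt{c\,p_{t_j}}$, where $e_i$ are the columns of $\mathbf{I}_n$. An index $i$ with $p_i=0$ is never selected. *)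

(* Defs.v *)
From HB Require Import structures.
From mathcomp Require Import all_boot all_order all_algebra.
From mathcomp Require Import all_classical all_reals all_analysis.
Set Implicit Arguments.
Unset Strict Implicit.
Unset Printing Implicit Defensive.
Import Order.TTheory GRing.Theory Num.Theory.
Local Open Scope classical_set_scope.
Local Open Scope ring_scope.

(* The canonical norm `|v| on matrices is the entrywise max-norm, hence explicit
   two-norm and Frobenius norm. *)
Definition norm2 (R : realType) (m : nat) (v : 'cV[R]_m) : R :=
  Num.sqrt (\sum_(i < m) v i 0 ^+ 2).

Definition normF (R : realType) (m n : nat) (A : 'M[R]_(m, n)) : R :=
  Num.sqrt (\sum_(i < m) \sum_(j < n) A i j ^+ 2).

(* The squared norms are nonnegative, so the default value 0 of the iterated
   maximum is harmless as soon as n > 0. *)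
Definition coherence (R : realType) (m n : nat) (Q : 'M[R]_(m, n)) : R :=
  \big[Num.max/0]_(j < n) (norm2 (col j Q) ^+ 2).

(* Square roots of the largest and smallest eigenvalues of A A^T. For m > 0 the
   spectrum of the symmetric m x m matrix A A^T is a finite nonempty set of
   reals, so sup and inf are a maximum and a minimum. The smallest one is the
   m-th largest singular value of A, and it is 0 when A has fewer than m columns
   or, more generally, is not of full row rank. *)
Definition sigma_first (R : realType) (m c : nat) (A : 'M[R]_(m, c)) : R :=
  Num.sqrt (sup [set a : R | eigenvalue (A *m A^T) a]).

Definition sigma_last (R : realType) (m c : nat) (A : 'M[R]_(m, c)) : R :=
  Num.sqrt (inf [set a : R | eigenvalue (A *m A^T) a]).

(* Only meaningful when 0 < sigma_last A, i.e. when A has full row rank: the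
   quotient is 0 otherwise, so upper bounds on it must come with that
   positivity condition. *)
Definition kappa (R : realType) (m c : nat) (A : 'M[R]_(m, c)) : R :=
  sigma_first A / sigma_last A.

Definition kappa_le (R : realType) (m c : nat) (A : 'M[R]_(m, c)) (b : R) : Prop :=
  0 < sigma_last A /\ kappa A <= b.

(* Column j is e_(t j) / sqrt (c * p_(t j)). *)
Definition sampling_matrix (R : realType) (n c : nat) (p : 'I_n -> R)
    (t : 'I_c -> 'I_n) : 'M[R]_(n, c) :=
  \matrix_(i < n, j < c) ((i == t j)%:R / Num.sqrt (c%:R * p (t j))).

Definition is_prob_vector (R : realType) (n : nat) (p : 'I_n -> R) : Prop :=
  (forall j, 0 <= p j) /\ \sum_(j < n) p j = 1.

(* Independence is the product rule for arbitrary subsets B j of the (discrete)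
   index set; subfamilies are covered by taking B j = setT for the other j. *)
Definition mutually_independent (R : realType) (d : measure_display)
    (T : measurableType d) (P : probability T R) (n c : nat)
    (t : 'I_c -> T -> 'I_n) : Prop :=
  forall B : 'I_c -> set 'I_n,
    P (\bigcap_(j in [set: 'I_c]) (t j @^-1` B j)) =
    (\prod_(j < c) P (t j @^-1` B j))%E.

Definition sampled_indices (R : realType) (d : measure_display)
    (T : measurableType d) (P : probability T R) (n c : nat) (p : 'I_n -> R)
    (t : 'I_c -> T -> 'I_n) : Prop :=
  [/\ forall j i, measurable (t j @^-1` [set i]),
      forall j i, P (t j @^-1` [set i]) = (p i)%:E
    & mutually_independent P t].

Definition c0 (R : realType) (eps : R) : R := 2 + 2 / 3 * eps.

(* Main.v *)
Require Import Defs.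
From HB Require Import structures.
From mathcomp Require Import all_boot all_order all_algebra.
From mathcomp Require Import all_classical all_reals all_analysis.
From mathcomp Require Import complex ring lra.
Set Implicit Arguments.
Unset Strict Implicit.
Unset Printing Implicit Defensive.
Import Order.TTheory GRing.Theory Num.Theory.
Local Open Scope classical_set_scope.
Local Open Scope ring_scope.

(** Write Y = (QS)(QS)^T.  It is a sum of c independent copies of a random
    rank-one matrix x x^T with mean 1/c times the identity and |x|^2 <= L,
    where L = m / (beta c) for nearly optimal and L = n mu / c for uniform
    probabilities.  Both sampling modes reduce to
    [condition_number_sampling], which is phrased in terms of L.

    If the bound on the condition number fails, Y has eigenvalues l1, l2 with
    l2 (1 + eps) <= l1 (1 - eps) ([kappa_le_spectrum]).  With the weights
    w1 = (1 - eps) / 2 and w2 = (1 + eps) / 2, which add up to 1, this says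
    that w1 (l1 - 1) + w2 (1 - l2) >= eps, so that by convexity
      exp (th eps) <= w1 exp (th (l1 - 1)) + w2 exp (th (1 - l2))
                   <= w1 exp (- th) tr exp (th Y) + w2 exp th tr exp (- th Y)
    for th >= 0.  Markov's inequality thus bounds the probability of failure
    by a convex combination of the two one-sided matrix Chernoff bounds; a
    union bound would add them up and yield ln (2 m / delta) where the theorem
    has ln (m / delta).

    For the trace of the exponential one peels off the samples one by one: by
    the Golden-Thompson inequality tr exp (A + s X) <= tr (exp A exp (s X)),
    and exp (s X) = 1 + g X with g <= (exp (s L) - 1) / L because X has rank
    one, so averaging over X multiplies the trace by at most
    1 + (exp (s L) - 1) / (L c).  After c samples the trace is at most
    m exp ((exp (s L) - 1) / L).  Taking th L = eps / (1 + eps / 3), Bernstein's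
    estimate exp v <= 1 + v + v^2 / (2 (1 - v / 3)) turns this into the failure
    probability m exp (- eps^2 / (c0 L)), which is at most delta by the
    assumption on c.

    The matrix exponential is replaced by (1 + s Y / N)^N with N = 2^k, which
    is a polynomial in Y.  For such powers the Golden-Thompson inequality
    holds up to an error O(1/N) ([golden_thompson_approx]), because it is exact
    for products: tr (A B)^N <= tr (A^N B^N) for symmetric A and B
    ([golden_thompson_pow2]).  All errors vanish as k grows, with constants
    that depend on the finitely many samples only ([le_of_le_pow2]). *)

(** * Trace inequalities for powers of matrices *)

Lemma trmx_expr (R : comPzRingType) (m : nat) (A : 'M[R]_m) (k : nat) :
  (A ^+ k)^T = A^T ^+ k.
Proof.
elim: k => [|k IHk]; first by rewrite !expr0 trmx1.
by rewrite exprS -mulmxE trmx_mul IHk mulmxE -exprSr.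
Qed.

Lemma mxtrace_exprC (R : comPzRingType) (m : nat) (A B : 'M[R]_m) (k : nat) :
  \tr ((A * B) ^+ k) = \tr ((B * A) ^+ k).
Proof.
case: k => [|k]; first by rewrite !expr0.
have cyc : (A * B) ^+ k.+1 = A * ((B * A) ^+ k * B).
  elim: k => [|k IHk]; first by rewrite expr1 expr0 mul1r.
  by rewrite exprS IHk exprS !mulrA.
by rewrite cyc -mulmxE mxtrace_mulC mulmxE -mulrA -exprSr.
Qed.

Section TraceInequalities.
Variables (R : realDomainType).

Lemma mxtrace_mulT_ge0 (m n : nat) (A : 'M[R]_(m, n)) : 0 <= \tr (A *m A^T).
Proof.
apply: sumr_ge0 => i _; rewrite mxE; apply: sumr_ge0 => j _.
by rewrite mxE -expr2 sqr_ge0.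
Qed.

Lemma mxtrace_even_expr_ge0 (m : nat) (A : 'M[R]_m) (k : nat) :
  A^T = A -> 0 <= \tr (A ^+ (2 ^ k.+1)).
Proof.
move=> symA; rewrite expnS mul2n -addnn exprD -{2}symA -trmx_expr.
exact: mxtrace_mulT_ge0.
Qed.

Lemma mxtrace_mulT_eq0 (m n : nat) (A : 'M[R]_(m, n)) :
  \tr (A *m A^T) = 0 -> A = 0.
Proof.
have AAT i : 0 <= (A *m A^T) i i.
  by rewrite mxE; apply: sumr_ge0 => j _; rewrite mxE -expr2 sqr_ge0.
move=> /psumr_eq0P A0; apply/matrixP => i j; rewrite [RHS]mxE; apply/eqP.
have /eqP := A0 (fun i _ => AAT i) i isT; rewrite mxE psumr_eq0 => [/allP|k _].
  by move=> /(_ j (mem_index_enum _)); rewrite mxE -expr2 sqrf_eq0.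
by rewrite mxE -expr2 sqr_ge0.
Qed.

Lemma mxtrace_mul_AGM (m : nat) (A B : 'M[R]_m) :
  \tr (A * B) *+ 2 <= \tr (A * A^T) + \tr (B * B^T).
Proof.
have cross : \tr (B^T *m A^T) = \tr (A *m B) by rewrite -trmx_mul mxtrace_tr.
have := mxtrace_mulT_ge0 (A - B^T).
rewrite linearB /= trmxK mulmxBl !mulmxBr !linearB /= cross.
rewrite (mxtrace_mulC B^T B) -!mulmxE; lra.
Qed.

(** Golden's induction.  The second inequality at k with M = A B reduces the
    exponent of the first one from k + 1 to k with A, B replaced by their
    squares.  Conversely M^2 (M^2)^T has the same power traces as
    (M^T M) (M M^T), a product of symmetric matrices to which the first
    inequality applies; the arithmetic-geometric mean inequality then splits
    the product, as M^T M and M M^T have the same power traces. *)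
Lemma golden_thompson_pow2 (m k : nat) :
  (forall A B : 'M[R]_m, A^T = A -> B^T = B ->
     \tr ((A * B) ^+ (2 ^ k)) <= \tr (A ^+ (2 ^ k) * B ^+ (2 ^ k)))
  /\ (forall M : 'M[R]_m,
     \tr (M ^+ (2 ^ k.+1)) <= \tr ((M * M^T) ^+ (2 ^ k))).
Proof.
elim: k => [|k [IHA IHM]].
  split=> [A B _ _|M]; rewrite ?expn0 ?expn1 !expr1 //.
  have := mxtrace_mul_AGM M M; rewrite expr2; lra.
split=> [A B symA symB|M].
  apply: (le_trans (IHM (A * B))).
  rewrite -mulmxE trmx_mul symA symB mulmxE -mulrA mxtrace_exprC.
  rewrite -!mulrA -expr2 mulrA -expr2 mxtrace_exprC expnS !exprM.
  by apply: IHA; rewrite trmx_expr ?symA ?symB.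
have -> : M ^+ (2 ^ k.+2) = (M ^+ 2) ^+ (2 ^ k.+1) by rewrite -exprM -expnS.
apply: (le_trans (IHM _)).
have -> : M ^+ 2 * (M ^+ 2)^T = M * (M * M^T * M^T).
  by rewrite trmx_expr !expr2 !mulrA.
rewrite mxtrace_exprC -!mulrA mulrA mxtrace_exprC.
have symL : (M^T * M)^T = M^T * M by rewrite -mulmxE trmx_mul trmxK.
have symR : (M * M^T)^T = M * M^T by rewrite -mulmxE trmx_mul trmxK.
apply: (le_trans (IHA _ _ symL symR)).
have := mxtrace_mul_AGM ((M^T * M) ^+ (2 ^ k)) ((M * M^T) ^+ (2 ^ k)).
rewrite !trmx_expr symL symR -!exprD addnn -mul2n -expnS (mxtrace_exprC M^T).
lra.
Qed.

(** The compression of K K^T to the orthogonal complement of v has nonnegative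
    trace; P below is |v|^2 times the projection onto that complement. *)
Lemma rayleigh_le_mxtrace (m n : nat) (K : 'M[R]_(m, n)) (v : 'rV[R]_m) :
  \tr (v *m (K *m K^T) *m v^T) <= \tr (K *m K^T) * \tr (v *m v^T).
Proof.
set q := \tr (v *m v^T).
have q_ge0 : 0 <= q := mxtrace_mulT_ge0 v.
have vvT : v *m v^T = q%:M.
  by rewrite [LHS]mx11_scalar /q [in RHS]/mxtrace big_ord1.
set P := q%:M - v^T *m v.
have symP : P^T = P by rewrite /P linearB /= tr_scalar_mx trmx_mul trmxK.
have PP : P *m P = q *: P.
  rewrite /P mulmxBl !mulmxBr -!scalar_mxM !mul_scalar_mx mul_mx_scalar.
  rewrite -mulmxA (mulmxA v) vvT mul_scalar_mx -scalemxAr scalerBr scale_scalar_mx.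
  by rewrite subrr subr0.
have := mxtrace_mulT_ge0 (P *m K).
have -> : \tr (P *m K *m (P *m K)^T) =
    q * (q * \tr (K *m K^T) - \tr (v *m (K *m K^T) *m v^T)).
  rewrite trmx_mul symP -mulmxA mxtrace_mulC -!mulmxA PP.
  rewrite -!scalemxAr linearZ /=; congr (_ * _).
  rewrite /P !mulmxBr linearB /= mul_mx_scalar -scalemxAr linearZ /=.
  by rewrite !mulmxA (mxtrace_mulC _ v) !mulmxA.
have [q0 _|q_neq0] := eqVneq q 0.
  by rewrite (mxtrace_mulT_eq0 q0) !mul0mx linear0 mulr_ge0 ?mxtrace_mulT_ge0.
by rewrite pmulr_rge0 ?lt0r ?q_neq0// subr_ge0 mulrC.
Qed.
End TraceInequalities.

(** * The Golden-Thompson inequality up to an error of order 1/N *)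

Section RowSumBound.
Variables (R : realType) (m : nat).
Implicit Types A B X Y : 'M[R]_m.

(** The operator norm induced by the sup norm is at most r.  A norm of an
    operator is required, rather than an entrywise one, so that the identity
    has norm 1 and the N-th powers of 1 + O(1/N) remain bounded. *)
Definition rowsum_le A (r : R) := forall i, \sum_j `|A i j| <= r.

Lemma rowsum_leW A (r s : R) : r <= s -> rowsum_le A r -> rowsum_le A s.
Proof. by move=> rs Ar i; apply: le_trans rs. Qed.

Lemma rowsum_le_sum A : rowsum_le A (\sum_i \sum_j `|A i j|).
Proof.
move=> i; rewrite [leRHS](bigD1 i) //= lerDl.
by apply: sumr_ge0 => k _; apply: sumr_ge0.
Qed.

Lemma rowsum_leD A B (r s : R) :
  rowsum_le A r -> rowsum_le B s -> rowsum_le (A + B) (r + s).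
Proof.
move=> Ar Bs i; apply: le_trans (lerD (Ar i) (Bs i)).
by rewrite -big_split /=; apply: ler_sum => j _; rewrite mxE ler_normD.
Qed.

Lemma rowsum_leZ A (a r : R) : rowsum_le A r -> rowsum_le (a *: A) (`|a| * r).
Proof.
move=> Ar i; apply: le_trans (ler_wpM2l (normr_ge0 a) (Ar i)).
by rewrite mulr_sumr; apply: ler_sum => j _; rewrite mxE normrM.
Qed.

Lemma rowsum_le1 : rowsum_le 1 1.
Proof.
move=> i; rewrite (bigD1 i) //= big1 => [|j /negPf ji].
  by rewrite addr0 mxE eqxx normr1.
by rewrite mxE eq_sym ji normr0.
Qed.

Lemma rowsum_leM A B (r s : R) :
  rowsum_le A r -> rowsum_le B s -> rowsum_le (A * B) (r * s).
Proof.
move=> Ar Bs i.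
have s_ge0 : 0 <= s by apply: le_trans (Bs i); apply: sumr_ge0.
apply: le_trans (ler_wpM2r s_ge0 (Ar i)); rewrite mulr_suml.
apply: (@le_trans _ _ (\sum_j \sum_k `|A i k| * `|B k j|)).
  apply: ler_sum => j _; rewrite -mulmxE mxE.
  apply: le_trans (ler_norm_sum _ _ _) _.
  by apply: ler_sum => k _; rewrite normrM.
rewrite exchange_big /=; apply: ler_sum => k _.
by rewrite -mulr_sumr ler_wpM2l.
Qed.

Lemma rowsum_leX A (r : R) (k : nat) : rowsum_le A r -> rowsum_le (A ^+ k) (r ^+ k).
Proof.
move=> Ar; elim: k => [|k IHk]; first by rewrite !expr0; apply: rowsum_le1.
by rewrite !exprS; apply: rowsum_leM.
Qed.

(** Telescoping A^(k+1) - B^(k+1) = A (A^k - B^k) + (A - B) B^k. *)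
Lemma rowsum_leXB A B (r e : R) (k : nat) : 1 <= r ->
  rowsum_le A r -> rowsum_le B r -> rowsum_le (A - B) e ->
  rowsum_le (A ^+ k - B ^+ k) (k%:R * e * r ^+ k).
Proof.
move=> r_ge1 Ar Br ABe; elim: k => [|k IHk].
  by rewrite !expr0 subrr !mul0r => i; rewrite big1 // => j _; rewrite mxE normr0.
have -> : A ^+ k.+1 - B ^+ k.+1 = A * (A ^+ k - B ^+ k) + (A - B) * B ^+ k.
  by rewrite !exprS mulrBr mulrBl addrA subrK.
move=> i.
have e_ge0 : 0 <= e by apply: le_trans (ABe i); apply: sumr_ge0.
apply: le_trans (rowsum_leD (rowsum_leM Ar IHk) (rowsum_leM ABe (rowsum_leX k Br)) i) _.
have rk : r ^+ k <= r ^+ k.+1.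
  by rewrite exprS ler_peMl // exprn_ge0 // (le_trans _ r_ge1).
have : e * r ^+ k <= e * r ^+ k.+1 by rewrite ler_wpM2l.
rewrite -natr1 exprS; lra.
Qed.

Lemma mxtrace_rowsum_le A (r : R) : rowsum_le A r -> \tr A <= m%:R * r.
Proof.
move=> Ar.
have -> : m%:R * r = \sum_(i < m) r by rewrite sumr_const card_ord mulr_natl.
rewrite /mxtrace; apply: ler_sum => i _; apply: le_trans (ler_norm _) _.
by apply: le_trans (Ar i); rewrite (bigD1 i) //= lerDl sumr_ge0.
Qed.

(** 1 + (Y + X) / N differs from (1 + Y / N) (1 + X / N) by Y X / N^2 only, and
    raising to the power N multiplies this difference by at most
    N exp (2 K). *)
Lemma golden_thompson_approx X Y (K : R) (k : nat) (N := (2 ^ k)%N) :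
  0 <= K -> X^T = X -> Y^T = Y -> rowsum_le X K -> rowsum_le Y K ->
  \tr ((1 + N%:R^-1 *: (Y + X)) ^+ N) <=
  \tr ((1 + N%:R^-1 *: Y) ^+ N * (1 + N%:R^-1 *: X) ^+ N)
  + m%:R * (K ^+ 2 * expR (2 * K)) / N%:R.
Proof.
move=> K_ge0 symX symY XK YK.
have N_gt0 : 0 < N%:R :> R by rewrite ltr0n expn_gt0.
set x := N%:R^-1 : R; have x_gt0 : 0 < x by rewrite invr_gt0.
have symD (Z : 'M[R]_m) : Z^T = Z -> (1 + x *: Z)^T = 1 + x *: Z.
  by move=> symZ; rewrite linearD /= linearZ /= symZ trmx1.
have [GT _] := golden_thompson_pow2 R m k.
have := GT _ _ (symD _ symY) (symD _ symX); rewrite -/N => {}GT.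
suff : \tr ((1 + x *: (Y + X)) ^+ N - ((1 + x *: Y) * (1 + x *: X)) ^+ N) <=
    m%:R * (K ^+ 2 * expR (2 * K)) / N%:R.
  by rewrite linearB /= lerBlDl => /le_trans -> //; rewrite lerD2r GT.
have bnd Z c : rowsum_le Z c -> rowsum_le (1 + x *: Z) (1 + x * c).
  move=> Zc; apply: rowsum_leD; first exact: rowsum_le1.
  by rewrite -[X in X * _](gtr0_norm x_gt0); apply: rowsum_leZ.
set r := (1 + x * K) * (1 + x * K).
have xK : 0 <= x * K by rewrite mulr_ge0 // ltW.
have r_ge1 : 1 <= r by rewrite /r; nra.
have rN : r ^+ N <= expR (2 * K).
  have -> : 2 * K = N%:R * (2 * (x * K)) by rewrite /x; field; rewrite lt0r_neq0.
  rewrite expRM_natl lerXn2r ?nnegrE ?expR_ge0 ?(le_trans _ r_ge1) //.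
  by rewrite expRM_natl expr2 ler_pM ?expR_ge1Dx //; lra.
have dXY : 1 + x *: (Y + X) - (1 + x *: Y) * (1 + x *: X)
    = - (x * x) *: (Y * X).
  rewrite mulrDl mul1r mulrDr mulr1 scalerDr -!mulmxE -scalemxAl -scalemxAr.
  rewrite scalerA scaleNr (addrC (x *: Y)); apply/eqP.
  by rewrite subr_eq [eqbRHS]addrC !addrA addrK.
have YXK : rowsum_le (Y + X) (K + K) by apply: rowsum_leD.
have Y1r : rowsum_le (1 + x *: (Y + X)) r.
  by apply: rowsum_leW (bnd _ _ YXK); rewrite /r; nra.
have YX1r : rowsum_le ((1 + x *: Y) * (1 + x *: X)) r.
  by apply: rowsum_leM; apply: bnd.
have xx_ge0 : 0 <= x * x by rewrite mulr_ge0 // ltW.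
have := rowsum_leXB N r_ge1 Y1r YX1r; rewrite {}dXY => /(_ (x * x * (K * K))) XB.
have {XB}/mxtrace_rowsum_le /le_trans -> // : rowsum_le
    ((1 + x *: (Y + X)) ^+ N - ((1 + x *: Y) * (1 + x *: X)) ^+ N)
    (N%:R * (x * x * (K * K)) * r ^+ N).
  apply: XB; have <- : `|- (x * x)| * (K * K) = x * x * (K * K).
    by rewrite normrN (ger0_norm xx_ge0).
  by apply: rowsum_leZ; apply: rowsum_leM.
rewrite -[leRHS]mulrA ler_wpM2l //.
have -> : N%:R * (x * x * (K * K)) = K ^+ 2 * x.
  by rewrite /x; field; rewrite lt0r_neq0.
by rewrite -/x mulrAC ler_wpM2r ?(ltW x_gt0) // ler_wpM2l ?sqr_ge0.
Qed.
End RowSumBound.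

(** * Eigenvalues and rank-one factors *)

(** M^(2k) = M^k (M^k)^T is positive semidefinite, so its trace bounds each of
    its eigenvalues. *)
Lemma eigenvalue_expr_le_mxtrace (R : realFieldType) (m : nat) (M : 'M[R]_m)
    (l : R) (k : nat) :
  M^T = M -> eigenvalue M l -> l ^+ (k + k) <= \tr (M ^+ (k + k)).
Proof.
move=> symM /eigenvalueP[v vM v_neq0].
have vMk j : v *m M ^+ j = l ^+ j *: v.
  elim: j => [|j IHj]; first by rewrite !expr0 scale1r [LHS]mulmx1.
  by rewrite exprSr -mulmxE mulmxA IHj -scalemxAl vM scalerA exprSr.
have symMk : (M ^+ k)^T = M ^+ k by rewrite trmx_expr symM.
have := rayleigh_le_mxtrace (M ^+ k) v.
rewrite symMk [M ^+ k *m M ^+ k](esym (exprD _ _ _)) vMk -scalemxAl linearZ /=.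
rewrite ler_pM2r // lt0r mxtrace_mulT_ge0 andbT.
by apply: contra v_neq0 => /eqP /mxtrace_mulT_eq0 ->.
Qed.

(** Convexity: the chord of the exponential from 0 to s L lies above the
    graph. *)
Lemma chord_expR (R : realType) (s l L : R) : 0 < L -> 0 <= l <= L ->
  expR (s * l) <= 1 + l * ((expR (s * L) - 1) / L).
Proof.
move=> L_gt0 /andP[l_ge0 l_le].
have t0 : 0 <= l / L by rewrite divr_ge0 // ltW.
have t1 : l / L <= 1 by rewrite ler_pdivrMr // mul1r.
have := convex_expR (Itv01 t0 t1) (s * L) 0.
rewrite !convRE /= expR0.
rewrite /unstable.onem mulr0 addr0 mulr1.
have -> : l / L * (s * L) = s * l by field; rewrite lt0r_neq0.
move=> /le_trans -> //; rewrite le_eqVlt; apply/orP; left; apply/eqP.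
by field; rewrite lt0r_neq0.
Qed.

Section RankOne.
Variables (R : realType) (m : nat).
Implicit Types (x : 'cV[R]_m).

Lemma rank1_sqr x : (x *m x^T) * (x *m x^T) = \tr (x *m x^T) *: (x *m x^T).
Proof.
have xTx : x^T *m x = (\tr (x *m x^T))%:M.
  by rewrite mxtrace_mulC [LHS]mx11_scalar /mxtrace big_ord1.
by rewrite -mulmxE mulmxA -(mulmxA x) xTx mul_mx_scalar -scalemxAl.
Qed.

(** A rank-one X satisfies X^2 = (tr X) X, so powers of 1 + a X stay in the span
    of 1 and X; the coefficient is read off on the eigenvalue tr X. *)
Lemma rank1_expr x (a : R) (k : nat) (X := x *m x^T) :
  exists2 b, (1 + a *: X) ^+ k = 1 + b *: X & 1 + b * \tr X = (1 + a * \tr X) ^+ k.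
Proof.
elim: k => [|k [b IHX IHtr]].
  by exists 0; rewrite !expr0 ?scale0r ?mul0r addr0.
exists (b + a + b * a * \tr X); rewrite exprSr.
  rewrite IHX mulrDl mul1r mulrDr mulr1 -!mulmxE -scalemxAl -scalemxAr.
  rewrite [X *m X]rank1_sqr -/X !scalerA !scalerDl !addrA.
  by rewrite (addrAC 1).
by rewrite -IHtr; ring.
Qed.

(** The coefficient b of X in (1 + s X / N)^N satisfies
    1 + b tr X <= exp (s tr X), and the chord bound makes it at most
    (exp (s L) - 1) / L uniformly in X.  The bound on |s| L keeps the base
    1 + s tr X / N nonnegative, also for s < 0. *)
Lemma mxtrace_mul_rank1_le x (A : 'M[R]_m) (s L : R) (k : nat)
    (N := (2 ^ k.+1)%N) (X := x *m x^T) :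
  A^T = A -> 0 < L -> \tr X <= L -> `|s| * L <= N%:R ->
  \tr (A ^+ N * (1 + (N%:R^-1 * s) *: X) ^+ N) <=
  \tr (A ^+ N) + (expR (s * L) - 1) / L * \tr (A ^+ N * X).
Proof.
move=> symA L_gt0 trX sLN.
have trX_ge0 : 0 <= \tr X := mxtrace_mulT_ge0 x.
have N_gt0 : 0 < N%:R :> R by rewrite ltr0n expn_gt0.
have [b] := rank1_expr x (N%:R^-1 * s) N; rewrite -/X => -> btr.
rewrite mulrDr mulr1 linearD /= lerD2l -!mulmxE -scalemxAr linearZ /=.
have symA2 : (A ^+ (2 ^ k))^T = A ^+ (2 ^ k) by rewrite trmx_expr symA.
have AX_ge0 : 0 <= \tr (A ^+ N *m X).
  rewrite /N expnS mul2n -addnn exprD -mulmxE -mulmxA mxtrace_mulC -{2}symA2.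
  have := mxtrace_mulT_ge0 (A ^+ (2 ^ k) *m x).
  by rewrite trmx_mul !mulmxA.
have [X0|X_neq0] := eqVneq (\tr X) 0.
  have -> : X = 0 by rewrite /X (mxtrace_mulT_eq0 X0) mul0mx.
  by rewrite mulmx0 linear0 !mulr0.
apply: ler_wpM2r => //.
have X_gt0 : 0 < \tr X by rewrite lt0r X_neq0.
rewrite -(ler_pM2r X_gt0) -(lerD2l 1) btr.
have base_ge0 : 0 <= 1 + N%:R^-1 * s * \tr X.
  have : - (`|s| * L) <= s * \tr X.
    rewrite lerNl -mulNr; apply: (@le_trans _ _ (`|s| * \tr X)).
      by rewrite ler_wpM2r // -normrN ler_norm.
    by rewrite ler_wpM2l.
  rewrite -(pmulr_rge0 _ N_gt0) mulrDr mulr1 !mulrA divff ?lt0r_neq0 // mul1r.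
  lra.
apply: (@le_trans _ _ (expR (s * \tr X))).
  have -> : s * \tr X = N%:R * (N%:R^-1 * s * \tr X).
    by field; rewrite lt0r_neq0.
  by rewrite expRM_natl lerXn2r ?nnegrE ?expR_ge0 ?expR_ge1Dx.
by rewrite (mulrC (_ / L)); apply: chord_expR; rewrite // trX_ge0.
Qed.
End RankOne.

(** * The mean of the trace over the samples *)

Lemma big_tuple0 (R : nmodType) (T : finType) (F : 0.-tuple T -> R) :
  \sum_u F u = F [tuple].
Proof. by apply: big_pred1 => u; apply/esym/eqP; apply: tuple0. Qed.

Lemma big_tupleS (R : nmodType) (T : finType) (c : nat) (F : c.+1.-tuple T -> R) :
  \sum_u F u = \sum_i \sum_(u : c.-tuple T) F [tuple of i :: u].
Proof.
rewrite pair_big /=.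
rewrite (reindex (fun q : T * c.-tuple T => [tuple of q.1 :: q.2])) //=.
apply: onW_bij; exists (fun u => (thead u, [tuple of behead u])) => [[i u]|u] /=.
  by congr pair; apply: val_inj.
by rewrite [RHS]tuple_eta.
Qed.

Section Sampling.
Variables (R : realType) (m n : nat) (p : 'I_n -> R) (x : 'I_n -> 'cV[R]_m).
Variables (L rho : R).
Local Notation X i := (x i *m (x i)^T).
Hypotheses (p_ge0 : forall i, 0 <= p i) (p_sum1 : \sum_i p i = 1).
Hypotheses (L_gt0 : 0 < L) (trX_le : forall i, \tr (X i) <= L).
Hypothesis meanX : \sum_i p i *: X i = rho%:M.

Definition sample_weight (s : seq 'I_n) := \prod_(i <- s) p i.
Definition sample_gram (s : seq 'I_n) := \sum_(i <- s) X i.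

Lemma sample_weight_ge0 s : 0 <= sample_weight s.
Proof. exact: prodr_ge0. Qed.

Lemma sample_weight_sum1 c : \sum_(u : c.-tuple 'I_n) sample_weight u = 1.
Proof.
elim: c => [|c IHc].
  by rewrite big_tuple0 /sample_weight big_nil.
rewrite big_tupleS -[RHS]p_sum1; apply: eq_bigr => i _.
rewrite -[RHS]mulr1 -IHc mulr_sumr; apply: eq_bigr => u _.
by rewrite /sample_weight big_cons.
Qed.

Lemma sample_gram_sym s : (sample_gram s)^T = sample_gram s.
Proof.
rewrite /sample_gram linear_sum /=; apply: eq_bigr => i _.
by rewrite trmx_mul trmxK.
Qed.

Let growth (s : R) := expR ((expR (s * L) - 1) / L * rho).

(** As X has a scalar mean, averaging the previous rank-one bound over X gives
    back a multiple of tr A^N. *)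
Lemma mean_mxtrace_mul_le (A : 'M[R]_m) (s : R) (k : nat) (N := (2 ^ k.+1)%N) :
  A^T = A -> `|s| * L <= N%:R ->
  \sum_i p i * \tr (A ^+ N * (1 + (N%:R^-1 * s) *: X i) ^+ N) <=
  growth s * \tr (A ^+ N).
Proof.
move=> symA sLN.
have trA_ge0 : 0 <= \tr (A ^+ N) by apply: mxtrace_even_expr_ge0.
apply: le_trans (ler_wpM2r trA_ge0 (expR_ge1Dx _)).
set g := (expR (s * L) - 1) / L.
have -> : (1 + g * rho) * \tr (A ^+ N) =
    \sum_i p i * (\tr (A ^+ N) + g * \tr (A ^+ N * X i)).
  under eq_bigr do rewrite mulrDr mulrCA.
  rewrite big_split /= -mulr_suml p_sum1 -mulr_sumr mulrDl -!mulrA.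
  congr (_ + _ * _).
  under eq_bigr do rewrite -linearZ /= -mulmxE scalemxAr.
  by rewrite -linear_sum /= -mulmx_sumr meanX mul_mx_scalar linearZ.
by apply: ler_sum => i _; apply: ler_wpM2l => //; apply: mxtrace_mul_rank1_le.
Qed.

(** Induction on the number of samples: the first sample is added to Y, and
    split off again by the Golden-Thompson inequality once the other samples
    have been averaged out.  Each sample consumes K0 of the room K for the row
    sums, which keeps the error term of every step the same. *)
Lemma mean_mxtrace_expr_le (s K K0 : R) (k : nat) (N := (2 ^ k.+1)%N) :
  `|s| * L <= N%:R -> 0 <= K0 <= K -> (forall i, rowsum_le (s *: X i) K0) ->
  forall c (Y : 'M[R]_m), Y^T = Y -> rowsum_le Y (K - c%:R * K0) ->
  \sum_(u : c.-tuple 'I_n) sample_weight u *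
     \tr ((1 + N%:R^-1 *: (Y + s *: sample_gram u)) ^+ N) <=
  growth s ^+ c * \tr ((1 + N%:R^-1 *: Y) ^+ N)
  + (\sum_(j < c) growth s ^+ j) * (m%:R * (K ^+ 2 * expR (2 * K)) / N%:R).
Proof.
move=> sLN /andP[K0_ge0 K0K] XK0.
set e := m%:R * _ / _.
elim=> [|c IHc] Y symY YK.
  rewrite big_tuple0 /sample_weight /sample_gram !big_nil scaler0 addr0 big_ord0.
  by rewrite expr0 mul0r addr0.
rewrite big_tupleS.
have symX i : (s *: X i)^T = s *: X i by rewrite linearZ /= trmx_mul trmxK.
have step i : \sum_(u : c.-tuple 'I_n) sample_weight (i :: u) *
     \tr ((1 + N%:R^-1 *: (Y + s *: sample_gram (i :: u))) ^+ N) <=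
   p i * (growth s ^+ c * \tr ((1 + N%:R^-1 *: (Y + s *: X i)) ^+ N)
          + (\sum_(j < c) growth s ^+ j) * e).
  have := IHc (Y + s *: X i); rewrite linearD /= symY symX => /(_ erefl).
  have YX : rowsum_le (Y + s *: X i) (K - c%:R * K0).
    apply: rowsum_leW (rowsum_leD YK (XK0 i)).
    rewrite -natr1; lra.
  move=> /(_ YX) /(ler_wpM2l (p_ge0 i)); apply: le_trans.
  rewrite mulr_sumr le_eqVlt; apply/orP; left; apply/eqP; apply: eq_bigr => u _.
  by rewrite /sample_weight /sample_gram !big_cons mulrA (scalerDr s) (addrA Y).
apply: (le_trans (ler_sum _ (fun i _ => step i))).
have step2 i : p i * (growth s ^+ c * \tr ((1 + N%:R^-1 *: (Y + s *: X i)) ^+ N)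
          + (\sum_(j < c) growth s ^+ j) * e) <=
   growth s ^+ c * (p i * \tr ((1 + N%:R^-1 *: Y) ^+ N *
                        (1 + (N%:R^-1 * s) *: X i) ^+ N))
   + p i * (\sum_(j < c.+1) growth s ^+ j * e).
  rewrite [Z in _ <= Z + _]mulrCA -mulrDr; apply: ler_wpM2l => //.
  rewrite -mulr_suml big_ord_recr /= [Z in _ <= _ + Z]mulrDl.
  rewrite [Z in _ <= _ + Z]addrC addrA lerD2r -mulrDr.
  apply: ler_wpM2l; first by rewrite exprn_ge0 ?expR_ge0.
  rewrite -scalerA; apply: golden_thompson_approx => //.
  - by apply: le_trans K0K.
  - by apply: rowsum_leW (XK0 i).
  - apply: rowsum_leW YK; have : 0 <= c.+1%:R * K0 by rewrite mulr_ge0.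
    lra.
apply: (le_trans (ler_sum _ (fun i _ => step2 i))).
rewrite big_split /= -mulr_suml p_sum1 mul1r -mulr_suml lerD2r -mulr_sumr.
rewrite exprSr -mulrA; apply: ler_wpM2l; first by rewrite exprn_ge0 ?expR_ge0.
apply: mean_mxtrace_mul_le => //.
by rewrite linearD /= linearZ /= symY trmx1.
Qed.

Lemma mean_mxtrace_exp_le (s : R) c : exists D, forall k, `|s| * L <= (2 ^ k.+1)%:R ->
  \sum_(u : c.-tuple 'I_n) sample_weight u *
     \tr ((1 + ((2 ^ k.+1)%:R^-1 * s) *: sample_gram u) ^+ (2 ^ k.+1)) <=
  growth s ^+ c * m%:R + D / (2 ^ k.+1)%:R.
Proof.
pose K0 := \sum_i \sum_j \sum_l `|(s *: X i) j l|.
have in_ge0 i : 0 <= \sum_j \sum_l `|(s *: X i) j l|.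
  by apply: sumr_ge0 => j _; apply: sumr_ge0.
have K0_ge0 : 0 <= K0 by apply: sumr_ge0.
have XK0 i : rowsum_le (s *: X i) K0.
  apply: rowsum_leW (rowsum_le_sum _).
  by rewrite /K0 [leRHS](bigD1 i) //= lerDl sumr_ge0.
pose K := c%:R * K0 + K0.
have K0K : 0 <= K0 <= K by rewrite K0_ge0 lerDr mulr_ge0.
exists ((\sum_(j < c) growth s ^+ j) * (m%:R * (K ^+ 2 * expR (2 * K)))) => k sLN.
have := mean_mxtrace_expr_le sLN K0K XK0 (c := c) (trmx0 _ _ _).
rewrite scaler0 addr0 expr1n mxtrace1 mulrA.
have -> : K - c%:R * K0 = K0 by rewrite /K addrAC subrr add0r.
have rs0 : rowsum_le (0 : 'M[R]_m) K0.
  by move=> i; rewrite big1 // => j _; rewrite mxE normr0.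
move=> /(_ rs0); apply: le_trans; rewrite le_eqVlt; apply/orP; left; apply/eqP.
by apply: eq_bigr => u _; rewrite add0r scalerA.
Qed.
End Sampling.

(** * Scalar estimates for the exponential *)

Section ScalarBounds.
Variable R : realType.

Lemma expR_ge_partial (u : R) (k : nat) : 0 <= u ->
  series (exp_coeff u) k <= expR u.
Proof.
move=> u_ge0; apply: nondecreasing_cvgn_le; last exact: is_cvg_series_exp_coeff.
apply/nondecreasing_seqP => j; rewrite /series /= big_nat_recr //= lerDl.
by rewrite /exp_coeff /= divr_ge0 // exprn_ge0.
Qed.

Lemma factorial_ge (k : nat) : (2 * 3 ^ k <= k.+2`!)%N.
Proof.
elim: k => // k IHk; rewrite expnS mulnCA factS.
by apply: leq_mul.
Qed.

(** Since k! >= 2 * 3^(k-2), the tail of the exponential series is dominated by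
    a geometric series of ratio u / 3.  The induction bounds a partial sum
    together with the remainder of that geometric series. *)
Lemma expR_bernstein (u : R) : 0 <= u < 3 ->
  expR u <= 1 + u + u ^+ 2 / (2 * (1 - u / 3)).
Proof.
move=> /andP[u_ge0 u_lt3].
have q_gt0 : 0 < 1 - u / 3 by lra.
apply: limr_le; first exact: is_cvg_series_exp_coeff.
near=> k.
have k2 : (2 <= k)%N by near: k; exact: nbhs_infty_ge.
rewrite -(subnK k2) addn2; move: (k - 2)%N => j {k2}.
have : series (exp_coeff u) j.+2 + (u / 3) ^+ j * (u ^+ 2 / (2 * (1 - u / 3)))
    <= 1 + u + u ^+ 2 / (2 * (1 - u / 3)).
  elim: j => [|j IHj].
    rewrite /series /= !big_nat_recr //= big_geq // /exp_coeff /=.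
    by rewrite !expr1 !expr0 factS fact0 !divr1 add0r mul1r.
  apply: le_trans IHj.
  rewrite {1}/series /= big_nat_recr //= -/(series _ j.+2) -addrA lerD2l.
  rewrite /exp_coeff /=.
  have fact_le : 2 * 3 ^+ j <= j.+2`!%:R :> R.
    by rewrite -natrX -natrM ler_nat factorial_ge.
  have term_le : u ^+ j.+2 / j.+2`!%:R <= (u / 3) ^+ j * (u ^+ 2 / 2).
    have -> : (u / 3) ^+ j * (u ^+ 2 / 2) = u ^+ j.+2 / (2 * 3 ^+ j).
      rewrite expr_div_n -(addn2 j) exprD; field.
      by rewrite expf_neq0 // pnatr_eq0.
    rewrite ler_wpM2l ?exprn_ge0 // lef_pV2 ?posrE ?ltr0n ?fact_gt0 //.
  apply: le_trans (lerD term_le (lexx _)) _.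
  rewrite (exprSr _ j) le_eqVlt; apply/orP; left; apply/eqP.
  move: (u / 3) q_gt0 (_ ^+ j) => v v_lt1 w; field.
  by rewrite lt0r_neq0.
apply: le_trans; rewrite lerDl mulr_ge0 ?exprn_ge0 ?divr_ge0 ?sqr_ge0 //.
by rewrite mulr_ge0 // ltW.
Unshelve. all: by end_near.
Qed.

(** The product (1 + u + u^2/2) (1 - u + u^2/2) = 1 + u^4/4 is at least 1. *)
Lemma expRN_le_quadratic (u : R) : 0 <= u -> expR (- u) <= 1 - u + u ^+ 2 / 2.
Proof.
move=> u_ge0.
have e3 : 1 + u + u ^+ 2 / 2 <= expR u.
  apply: le_trans (expR_ge_partial 3 u_ge0).
  rewrite /series /= !big_nat_recr //= big_geq // /exp_coeff /=.
  by rewrite !expr1 !expr0 !factS fact0 !divr1 add0r.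
have u2 : 0 <= u ^+ 2 by apply: sqr_ge0.
rewrite expRN -(ler_pM2l (expR_gt0 u)) divff ?gt_eqF ?expR_gt0 //.
have q0 : 0 <= 1 - u + u ^+ 2 / 2 by nra.
apply: le_trans (ler_wpM2r q0 e3).
have : 0 <= (u ^+ 2) ^+ 2 by apply: sqr_ge0.
lra.
Qed.

(** With y = x / N and |y| < 1, 1 + y = (1 - y^2) / (1 - y) >= (1 - y^2) exp y,
    and Bernoulli's inequality handles (1 - y^2)^N.  For |x| >= N the left-hand
    side is nonpositive, and the right-hand side is an even power. *)
Lemma expr_ge_expR (x : R) (N : nat) : (0 < N)%N -> ~~ odd N ->
  (1 - x ^+ 2 / N%:R) * expR x <= (1 + x / N%:R) ^+ N.
Proof.
move=> N_gt0 N_even.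
have N_pos : 0 < N%:R :> R by rewrite ltr0n.
have [xN|xN] := lerP (N%:R) `|x|.
  apply: (@le_trans _ _ 0); last first.
    rewrite -(odd_double_half N) (negPf N_even) add0n -mul2n exprM.
    by rewrite exprn_ge0 ?sqr_ge0.
  apply: mulr_le0_ge0; last exact: expR_ge0.
  rewrite subr_le0 ler_pdivlMr // mul1r; apply: (le_trans xN).
  rewrite -real_normK ?num_real // expr2 ler_peMr //.
  by apply: le_trans xN; rewrite ler1n.
set y := x / N%:R.
have y_lt : `|y| < 1 by rewrite normrM normfV (gtr0_norm N_pos) ltr_pdivrMr // mul1r.
have {}y_lt : - 1 < y < 1 by rewrite -ltr_norml.
have [y1 y2] := andP y_lt.
have -> : x = N%:R * y by rewrite /y; field; rewrite lt0r_neq0.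
rewrite expRM_natl.
have -> : (N%:R * y) ^+ 2 / N%:R = N%:R * y ^+ 2 by field; rewrite lt0r_neq0.
have bernoulli k : 1 - k%:R * y ^+ 2 <= (1 - y ^+ 2) ^+ k.
  elim: k => [|k IHk]; first by rewrite mul0r subr0 expr0.
  have y2_ge0 : 0 <= 1 - y ^+ 2 by nra.
  rewrite (exprSr _ k); apply: le_trans (ler_wpM2r y2_ge0 IHk).
  have := mulr_ge0 (mulr_ge0 (ler0n R k) (sqr_ge0 y)) (sqr_ge0 y).
  rewrite -natr1; lra.
apply: le_trans (ler_wpM2r (exprn_ge0 _ (expR_ge0 _)) (bernoulli N)) _.
have y1_ge0 : 0 <= 1 + y by lra.
have ye_ge0 : 0 <= (1 - y ^+ 2) * expR y.
  by apply: mulr_ge0; [nra | exact: expR_ge0].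
rewrite -exprMn lerXn2r ?nnegrE //.
have -> : 1 - y ^+ 2 = (1 + y) * (1 - y) by ring.
rewrite -mulrA ler_piMr //.
rewrite -ler_pdivlMr ?expR_gt0 // mul1r -expRN.
exact: expR_ge1Dx.
Qed.

Lemma le_of_le_pow2 (a b D : R) (k0 : nat) :
  (forall k, (k0 <= k)%N -> a <= b + D / (2 ^ k)%:R) -> a <= b.
Proof.
move=> H; rewrite leNgt; apply/negP => ba.
pose k := maxn k0 (Num.truncn (`|D| / (a - b))).+1.
have := H k (leq_maxl _ _).
have k_gt0 : 0 < (2 ^ k)%:R :> R by rewrite ltr0n expn_gt0.
have : `|D| / (a - b) < (2 ^ k)%:R.
  apply: lt_le_trans (truncnS_gt _) _; rewrite ler_nat.
  by apply: leq_trans (ltnW (ltn_expl k _)) => //; apply: leq_maxr.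
rewrite ltr_pdivrMr ?subr_gt0 // -lerBlDl ler_pdivlMr // => H1 H2.
have := ler_norm D; lra.
Qed.
End ScalarBounds.

(** * The tail bound for the spectrum *)

Section Tail.
Variables (R : realType) (m n c : nat) (p : 'I_n -> R) (x : 'I_n -> 'cV[R]_m).
Variables (L eps : R).
Local Notation X i := (x i *m (x i)^T).
Hypotheses (c_gt0 : (0 < c)%N).
Hypotheses (p_ge0 : forall i, 0 <= p i) (p_sum1 : \sum_i p i = 1).
Hypotheses (L_gt0 : 0 < L) (trX_le : forall i, \tr (X i) <= L).
Hypothesis meanX : \sum_i p i *: X i = (c%:R^-1)%:M.
Hypothesis eps01 : 0 < eps < 1.

Local Notation rate := (eps ^+ 2 / (2 + 2 / 3 * eps)).

(** The value v = eps / (1 + eps / 3) makes v^2 / (2 (1 - v / 3)) equal to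
    v eps / 2, which is also equal to the rate eps^2 / (2 + 2 eps / 3).  The
    second inequality lets one exponent serve for both ends of the spectrum. *)
Lemma bernstein_exponent (v := eps / (1 + eps / 3)) :
  expR v - 1 - v <= v * eps - rate /\ expR (- v) - 1 + v <= v * eps - rate.
Proof.
have [e0 e1] := andP eps01.
have v_ge0 : 0 <= v by rewrite /v divr_ge0 //; lra.
have v_lt3 : v < 3 by rewrite /v ltr_pdivrMr; lra.
have target : v ^+ 2 / (2 * (1 - v / 3)) = v * eps - rate.
  by rewrite /v; field; apply/and3P; split; apply: lt0r_neq0; lra.
have v2 : v ^+ 2 / 2 <= v ^+ 2 / (2 * (1 - v / 3)).
  rewrite ler_wpM2l ?sqr_ge0 // lef_pV2 ?posrE; lra.
have := expR_bernstein (u := v); rewrite v_ge0 v_lt3 => /(_ isT).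
have := expRN_le_quadratic v_ge0.
by rewrite -target; split; lra.
Qed.

(** With mean 1/c times the identity, the c growth factors multiply up to an
    expression in which c no longer occurs.  The starting index k0 ensures
    |s| L <= 2^(k+1). *)
Lemma mean_mxtrace_exp_tail (s : R) (k0 := (Num.truncn (`|s| * L)).+1) :
  exists D, forall k, (k0 <= k)%N ->
  \sum_(u : c.-tuple 'I_n) sample_weight p u *
     \tr ((1 + ((2 ^ k.+1)%:R^-1 * s) *: sample_gram x u) ^+ (2 ^ k.+1)) <=
  expR ((expR (s * L) - 1) / L) * m%:R + D / (2 ^ k.+1)%:R.
Proof.
have [D HD] := mean_mxtrace_exp_le p_ge0 p_sum1 L_gt0 trX_le meanX s c.
exists D => k k0k.
have -> : expR ((expR (s * L) - 1) / L) =
    expR ((expR (s * L) - 1) / L * c%:R^-1) ^+ c.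
  by rewrite -expRM_natl mulrCA divff ?mulr1 // pnatr_eq0 -lt0n.
apply: HD; apply: (le_trans (ltW (truncnS_gt _))); rewrite ler_nat.
exact: (leq_trans k0k (leq_trans (leqnSn k) (ltnW (ltn_expl _ _)))).
Qed.

(** Markov's inequality for the functional E k, the polynomial approximation of
    w1 exp (- th) tr exp (th Y) + w2 exp th tr exp (- th Y).  On B it is at
    least exp (th eps) up to a factor 1 - O(1/N), and its mean is at most
    m exp (th eps - rate / L) up to O(1/N). *)
Lemma sample_spectrum_tail (B : pred (c.-tuple 'I_n)) :
  (forall u, B u -> exists l1 l2, [/\ eigenvalue (sample_gram x u) l1,
     eigenvalue (sample_gram x u) l2 & l2 * (1 + eps) <= l1 * (1 - eps)]) ->
  \sum_(u | B u) sample_weight p u <= m%:R * expR (- (rate / L)).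
Proof.
move=> Bspec; have [e0 e1] := andP eps01.
pose v := eps / (1 + eps / 3); pose th := v / L.
have v_ge0 : 0 <= v by rewrite /v divr_ge0 //; lra.
have thL : th * L = v by rewrite /th divfK ?gt_eqF.
have [D1 HD1] := mean_mxtrace_exp_tail th.
have [D2 HD2] := mean_mxtrace_exp_tail (- th).
pose w1 := (1 - eps) / 2; pose w2 := (1 + eps) / 2.
have w1_ge0 : 0 <= w1 by rewrite /w1; lra.
have w2_ge0 : 0 <= w2 by rewrite /w2; lra.
have w12 : w1 + w2 = 1 by rewrite /w1 /w2; lra.
have f1 : 0 <= w1 * expR (- th) := mulr_ge0 w1_ge0 (expR_ge0 _).
have f2 : 0 <= w2 * expR th := mulr_ge0 w2_ge0 (expR_ge0 _).
pose E k u := w1 * expR (- th) *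
     \tr ((1 + ((2 ^ k.+1)%:R^-1 * th) *: sample_gram x u) ^+ (2 ^ k.+1))
   + w2 * expR th *
     \tr ((1 + ((2 ^ k.+1)%:R^-1 * - th) *: sample_gram x u) ^+ (2 ^ k.+1)).
(* a bound for (th l)^2 that is uniform in the samples and the eigenvalues l *)
pose S2 := \sum_(u : c.-tuple 'I_n) th ^+ 2 * \tr (sample_gram x u ^+ 2).
have trG2_ge0 (u : seq 'I_n) : 0 <= \tr (sample_gram x u ^+ 2).
  by apply: (mxtrace_even_expr_ge0 0); apply: sample_gram_sym.
have S2_ge (u : c.-tuple 'I_n) l :
    eigenvalue (sample_gram x u) l -> (th * l) ^+ 2 <= S2.
  move=> /(@eigenvalue_expr_le_mxtrace _ _ _ _ 1 (sample_gram_sym _ _)).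
  rewrite exprMn => /(ler_wpM2l (sqr_ge0 th)) /le_trans -> //.
  rewrite /S2 (bigD1 u) //= lerDl; apply: sumr_ge0 => *.
  by rewrite mulr_ge0 ?sqr_ge0.
have eig_exp k (u : c.-tuple 'I_n) l s : eigenvalue (sample_gram x u) l ->
    `|s| = th -> (1 - S2 / (2 ^ k.+1)%:R) * expR (s * l) <=
   \tr ((1 + ((2 ^ k.+1)%:R^-1 * s) *: sample_gram x u) ^+ (2 ^ k.+1)).
  move=> lG sth; set N := (2 ^ k.+1)%N.
  have N_gt0 : (0 < N)%N by rewrite expn_gt0.
  have N_even : ~~ odd N by rewrite oddX.
  have lG' : eigenvalue (1 + (N%:R^-1 * s) *: sample_gram x u) (1 + s * l / N%:R).
    have /eigenvalueP[z zG z0] := lG; apply/eigenvalueP; exists z => //.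
    rewrite mulmxDr -scalemxAr zG scalerA scalerDl scale1r [_ *m 1]mulmx1.
    by congr (_ + _ *: _); rewrite [RHS]mulrC mulrA.
  have NN : N = (2 ^ k + 2 ^ k)%N by rewrite /N expnS mul2n addnn.
  have sym1 : (1 + (N%:R^-1 * s) *: sample_gram x u)^T =
      1 + (N%:R^-1 * s) *: sample_gram x u.
    by rewrite linearD linearZ /= trmx1 sample_gram_sym.
  have := eigenvalue_expr_le_mxtrace (2 ^ k) sym1 lG'; rewrite -NN.
  apply: le_trans; apply: le_trans (expr_ge_expR (s * l) N_gt0 N_even).
  apply: ler_wpM2r; first exact: expR_ge0.
  rewrite lerD2l lerN2 ler_pM2r ?invr_gt0 ?ltr0n //.
  apply: le_trans (S2_ge u l lG).
  by rewrite (exprMn _ s) (exprMn _ th) -[s ^+ 2]real_normK ?num_real // sth.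
have th_ge0 : 0 <= th by rewrite /th divr_ge0 // ltW.
have E_ge0 k u : 0 <= E k u.
  have sym1 s : (1 + s *: sample_gram x u)^T = 1 + s *: sample_gram x u.
    by rewrite linearD linearZ /= trmx1 sample_gram_sym.
  by apply: addr_ge0; apply: mulr_ge0 => //; apply: mxtrace_even_expr_ge0.
have E_bad k u : B u -> S2 <= (2 ^ k.+1)%:R ->
    (1 - S2 / (2 ^ k.+1)%:R) * expR (th * eps) <= E k u.
  move=> Bu kS2; have [l1 [l2 [l1G l2G l12]]] := Bspec u Bu.
  set q := 1 - S2 / _.
  have q_ge0 : 0 <= q by rewrite subr_ge0 ler_pdivrMr ?mul1r // ltr0n expn_gt0.
  have h1 := eig_exp k u l1 th l1G (ger0_norm th_ge0).
  have h2 := eig_exp k u l2 (- th) l2G (etrans (normrN th) (ger0_norm th_ge0)).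
  apply: le_trans (lerD (ler_wpM2l f1 h1) (ler_wpM2l f2 h2)).
  have -> : w1 * expR (- th) * ((1 - S2 / (2 ^ k.+1)%:R) * expR (th * l1)) +
     w2 * expR th * ((1 - S2 / (2 ^ k.+1)%:R) * expR (- th * l2)) =
     q * (w1 * expR (th * (l1 - 1)) + w2 * expR (th * (1 - l2))).
    have -> : th * (l1 - 1) = - th + th * l1 by ring.
    have -> : th * (1 - l2) = th + - th * l2 by ring.
    by rewrite !expRD /q; ring.
  apply: ler_wpM2l => //.
  (* convexity of the exponential, through its tangent at th * eps *)
  have tangent y : expR (th * eps) * (1 + (y - th * eps)) <= expR y.
    rewrite -[y in leRHS](subrKC (th * eps)) expRD.
    by apply: ler_wpM2l (expR_ge1Dx _); apply: expR_ge0.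
  apply: le_trans
    (lerD (ler_wpM2l w1_ge0 (tangent _)) (ler_wpM2l w2_ge0 (tangent _))).
  rewrite !(mulrCA _ (expR _)) -mulrDr ler_peMr ?expR_ge0 //.
  rewrite -subr_ge0.
  have -> : w1 * (1 + (th * (l1 - 1) - th * eps)) +
     w2 * (1 + (th * (1 - l2) - th * eps)) - 1 =
     th * (l1 * (1 - eps) - l2 * (1 + eps)) / 2 by rewrite /w1 /w2; field.
  by rewrite divr_ge0 // mulr_ge0 // subr_ge0.
pose W := \sum_(u | B u) sample_weight p u.
pose D := w1 * expR (- th) * D1 + w2 * expR th * D2.
apply: (@le_of_le_pow2 _ _ _ (D * expR (- (th * eps)) + W * S2)
  (maxn (Num.truncn (`|th| * L)).+1 (Num.truncn S2).+1).+1) => -[//|k].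
rewrite ltnS geq_max => /andP[k_th k_S2].
set N := (2 ^ k.+1)%N.
have N_gt0 : 0 < N%:R :> R by rewrite ltr0n expn_gt0.
have S2N : S2 <= N%:R.
  apply: (le_trans (ltW (truncnS_gt _))); rewrite ler_nat.
  exact: (leq_trans k_S2 (leq_trans (leqnSn k) (ltnW (ltn_expl _ _)))).
have upper : \sum_(u : c.-tuple 'I_n) sample_weight p u * E k u <=
    m%:R * expR (- (rate / L)) * expR (th * eps) + D / N%:R.
  have {}HD1 := HD1 k k_th.
  have {}HD2 := HD2 k; rewrite normrN in HD2; have {}HD2 := HD2 k_th.
  have -> : \sum_(u : c.-tuple 'I_n) sample_weight p u * E k u =
    w1 * expR (- th) * (\sum_(u : c.-tuple 'I_n) sample_weight p u *
     \tr ((1 + (N%:R^-1 * th) *: sample_gram x u) ^+ N)) +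
    w2 * expR th * (\sum_(u : c.-tuple 'I_n) sample_weight p u *
     \tr ((1 + (N%:R^-1 * - th) *: sample_gram x u) ^+ N)).
    rewrite !mulr_sumr -big_split; apply: eq_bigr => u _.
    by rewrite /E mulrDr !(mulrCA (sample_weight p u)).
  apply: le_trans (lerD (ler_wpM2l f1 HD1) (ler_wpM2l f2 HD2)) _.
  have [psi1 psi2] := bernstein_exponent; rewrite -/v in psi1 psi2.
  have combine s t : expR (s * L) - 1 - s * L <= v * eps - rate -> t = - s ->
      expR t * (expR ((expR (s * L) - 1) / L) * m%:R) <=
      m%:R * expR (- (rate / L)) * expR (th * eps).
    move=> psi ->; rewrite mulrA mulrC -mulrA -!expRD ler_wpM2l // ler_expR.
    rewrite -(ler_pM2r L_gt0) mulrDl divfK ?gt_eqF // mulrDl mulNr.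
    rewrite mulNr divfK ?gt_eqF // (mulrAC th) thL; lra.
  have c1 : expR (- th) * (expR ((expR (th * L) - 1) / L) * m%:R) <=
      m%:R * expR (- (rate / L)) * expR (th * eps).
    by apply: combine => //; rewrite thL.
  have c2 : expR th * (expR ((expR (- th * L) - 1) / L) * m%:R) <=
      m%:R * expR (- (rate / L)) * expR (th * eps).
    by apply: combine; rewrite ?opprK // mulNr thL opprK.
  have := lerD (ler_wpM2l w1_ge0 c1) (ler_wpM2l w2_ge0 c2).
  rewrite -mulrDl w12 mul1r /D mulrDr mulrDr; lra.
have lower : W * ((1 - S2 / N%:R) * expR (th * eps)) <=
    \sum_(u : c.-tuple 'I_n) sample_weight p u * E k u.
  rewrite [leRHS](bigID B) /= -[leLHS]addr0; apply: lerD.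
    rewrite mulr_suml; apply: ler_sum => u Bu.
    by apply: ler_wpM2l; [exact: sample_weight_ge0 | exact: E_bad].
  by apply: sumr_ge0 => u _; rewrite mulr_ge0 // sample_weight_ge0.
have ee : expR (th * eps) * expR (- (th * eps)) = 1.
  by rewrite -expRD subrr expR0.
have := ler_wpM2r (expR_ge0 (- (th * eps))) (le_trans lower upper).
move: (expR (th * eps)) (expR (- (th * eps))) ee => a a' ee.
have -> : W * ((1 - S2 / N%:R) * a) * a' = W * (1 - S2 / N%:R) * (a * a').
  by ring.
have -> : (m%:R * expR (- (rate / L)) * a + D / N%:R) * a' =
    m%:R * expR (- (rate / L)) * (a * a') + D * a' / N%:R by ring.
rewrite ee !mulr1 -/W; lra.
Qed.
End Tail.

(** * Condition numbers and random sampling *)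

(** A complex eigenvector a + i b with eigenvalue al + i be exists.  Comparing
    a A b^T with b A a^T, which agree by symmetry, gives be (|a|^2 + |b|^2) = 0;
    so be = 0, and whichever of a, b is nonzero is a real eigenvector. *)
Lemma symmetric_eigenvalue_exists (R : realType) (m : nat) (A : 'M[R]_m) :
  (0 < m)%N -> A^T = A -> exists l, eigenvalue A l.
Proof.
move=> m_gt0 symA.
pose toC := real_complex R.
have [z] : exists z, root (char_poly (map_mx toC A)) z.
  by apply/closed_rootP; rewrite size_char_poly eqSS -lt0n.
rewrite -eigenvalue_root_char => /eigenvalueP[v vA v_neq0].
case: z vA => al be vA.
pose a := \row_j complex.Re (v 0 j); pose b := \row_j complex.Im (v 0 j).
have re_sum (F : 'I_m -> R[i]) : complex.Re (\sum_j F j) = \sum_j complex.Re (F j).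
  by apply: (big_morph (@complex.Re R)) => // -[? ?] [].
have im_sum (F : 'I_m -> R[i]) : complex.Im (\sum_j F j) = \sum_j complex.Im (F j).
  by apply: (big_morph (@complex.Im R)) => // -[? ?] [].
have aA : a *m A = al *: a - be *: b.
  apply/rowP => j; have /rowP/(_ j) := vA; rewrite !mxE.
  move=> /(congr1 (@complex.Re R)).
  rewrite re_sum => E.
  rewrite [RHS](_ : _ = complex.Re ((al +i* be)%C * v 0 j)); last first.
    by case: (v 0 j).
  rewrite -E; apply: eq_bigr => k _; rewrite !mxE.
  by case: (v 0 k) => c d /=; rewrite mulr0 subr0.
have bA : b *m A = al *: b + be *: a.
  apply/rowP => j; have /rowP/(_ j) := vA; rewrite !mxE.
  move=> /(congr1 (@complex.Im R)).
  rewrite im_sum => E.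
  rewrite [RHS](_ : _ = complex.Im ((al +i* be)%C * v 0 j)); last first.
    by case: (v 0 j).
  rewrite -E; apply: eq_bigr => k _; rewrite !mxE.
  by case: (v 0 k) => c d /=; rewrite mulr0 add0r.
have norm_ge0 (w : 'rV[R]_m) : 0 <= \tr (w *m w^T) := mxtrace_mulT_ge0 w.
have dot_sym : \tr (a *m b^T) = \tr (b *m a^T).
  by rewrite -mxtrace_tr trmx_mul trmxK.
have be0 : be * (\tr (a *m a^T) + \tr (b *m b^T)) = 0.
  have : \tr (a *m A *m b^T) = \tr (b *m A *m a^T).
    by rewrite -mxtrace_tr !trmx_mul trmxK symA mulmxA.
  rewrite aA bA mulmxBl mulmxDl -!scalemxAl linearB linearD /= !linearZ /=.
  rewrite dot_sym [be *: _]mulrN; lra.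
have ab_neq0 : (a != 0) || (b != 0).
  rewrite -negb_and; apply: contra v_neq0 => /andP[/eqP a0 /eqP b0].
  apply/eqP/rowP => j; have /rowP/(_ j) := a0; have /rowP/(_ j) := b0.
  by rewrite !mxE; case: (v 0 j) => c d /= -> ->.
have {}be0 : be = 0.
  apply/eqP; move/eqP: be0; rewrite mulf_eq0 => /orP[//|].
  rewrite paddr_eq0 // => /andP[/eqP/mxtrace_mulT_eq0 a0 /eqP/mxtrace_mulT_eq0 b0].
  by move: ab_neq0; rewrite a0 b0 eqxx.
exists al; apply/eigenvalueP; case/orP: ab_neq0 => n0.
  by exists a => //; rewrite aA be0 scale0r subr0.
by exists b => //; rewrite bA be0 scale0r addr0.
Qed.
Section Coherence.
Variable R : realType.

Lemma norm2_sqr (m : nat) (v : 'cV[R]_m) : norm2 v ^+ 2 = \tr (v *m v^T).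
Proof.
rewrite sqr_sqrtr; last by apply: sumr_ge0 => i _; rewrite sqr_ge0.
by apply: eq_bigr => i _; rewrite mxE big_ord1 mxE expr2.
Qed.

Lemma normF_sqr (m n : nat) (A : 'M[R]_(m, n)) : normF A ^+ 2 = \tr (A *m A^T).
Proof.
rewrite sqr_sqrtr; last by do 2![apply: sumr_ge0 => ? _]; rewrite sqr_ge0.
apply: eq_bigr => i _; rewrite mxE.
by apply: eq_bigr => j _; rewrite mxE expr2.
Qed.

Lemma norm2_le_coherence (m n : nat) (Q : 'M[R]_(m, n)) i :
  norm2 (col i Q) ^+ 2 <= coherence Q.
Proof. exact: le_bigmax. Qed.

Lemma mulmxT_sum_col (m n : nat) (A : 'M[R]_(m, n)) :
  A *m A^T = \sum_j col j A *m (col j A)^T.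
Proof.
apply/matrixP => a b; rewrite mxE summxE; apply: eq_bigr => j _.
by rewrite !mxE big_ord1 !mxE.
Qed.

Lemma coherence_gt0 (m n : nat) (Q : 'M[R]_(m, n)) :
  (0 < m)%N -> Q *m Q^T = 1%:M -> 0 < coherence Q.
Proof.
move=> m_gt0 QQ; rewrite lt_neqAle eq_sym; apply/andP; split; last first.
  exact: bigmax_ge_id.
apply/negP => /eqP mu0.
have : \tr (Q *m Q^T) = 0.
  rewrite mulmxT_sum_col linear_sum big1 //= => i _; apply/eqP.
  rewrite -norm2_sqr eq_le sqr_ge0 andbT -mu0; exact: norm2_le_coherence.
by rewrite QQ mxtrace1 => /eqP; rewrite pnatr_eq0 gtn_eqF.
Qed.

(** The strict inequality with l1 = l2 shows that all eigenvalues are positive.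
    With l1 and l2 separate, it passes to the supremum and the infimum of the
    spectrum, and bounds the infimum away from 0. *)
Lemma kappa_le_spectrum (m c : nat) (A : 'M[R]_(m, c)) (eps : R) :
  (0 < m)%N -> 0 < eps < 1 ->
  (forall l1 l2, eigenvalue (A *m A^T) l1 -> eigenvalue (A *m A^T) l2 ->
     l1 * (1 - eps) < l2 * (1 + eps)) ->
  kappa_le A (Num.sqrt (1 + eps) / Num.sqrt (1 - eps)).
Proof.
move=> m_gt0 /andP[e0 e1] spec.
have symG : (A *m A^T)^T = A *m A^T by rewrite trmx_mul trmxK.
have [l lG] := symmetric_eigenvalue_exists m_gt0 symG.
pose S := [set a : R | eigenvalue (A *m A^T) a].
have l_gt0 : 0 < l by have := spec l l lG lG; nra.
have S_ub : has_ubound S.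
  exists (l * (1 + eps) / (1 - eps)) => a Sa.
  by rewrite ler_pdivlMr ?subr_gt0 //; apply/ltW/spec.
have S_lb a : S a -> sup S * (1 - eps) / (1 + eps) <= a.
  move=> Sa; rewrite ler_pdivrMr; last by lra.
  rewrite -ler_pdivlMr; last by lra.
  apply: ge_sup; first by exists l.
  by move=> b Sb; rewrite ler_pdivlMr ?subr_gt0 //; apply/ltW/spec.
have sup_gt0 : 0 < sup S by apply: lt_le_trans l_gt0 _; apply: ub_le_sup.
have inf_ge : sup S * (1 - eps) / (1 + eps) <= inf S.
  by apply: lb_le_inf => //; exists l.
have inf_gt0 : 0 < inf S.
  apply: lt_le_trans inf_ge; apply: divr_gt0; last by lra.
  by apply: mulr_gt0 => //; lra.
split; first by rewrite sqrtr_gt0.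
rewrite /kappa /sigma_first /sigma_last -/S.
rewrite ler_pdivrMr ?sqrtr_gt0 // mulrAC ler_pdivlMr ?sqrtr_gt0 ?subr_gt0 //.
rewrite -!sqrtrM ?(ltW sup_gt0) //; last by lra.
have inf_ge' : sup S * (1 - eps) <= inf S * (1 + eps).
  by rewrite -ler_pdivrMr //; lra.
rewrite ler_sqrt; first by lra.
by apply: mulr_ge0; [lra | exact: ltW].
Qed.
End Coherence.

(** The event is the disjoint union of the cylinders on which the sampled tuple
    is u, for the u in B. *)
Lemma sampled_event_prob (R : realType) (d : measure_display)
    (T : measurableType d) (P : probability T R) (n c : nat) (p : 'I_n -> R)
    (t : 'I_c -> T -> 'I_n) (B : pred (c.-tuple 'I_n)) :
  sampled_indices P p t ->
  P [set w | B [tuple t j w | j < c]] = (\sum_(u | B u) sample_weight p u)%:E.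
Proof.
move=> [t_meas t_prob t_indep].
pose F (u : c.-tuple 'I_n) := \bigcap_(j in [set: 'I_c]) (t j @^-1` [set tnth u j]).
have FE w u : F u w <-> [tuple t j w | j < c] = u.
  split=> [Fuw|<- j _ /=]; last by rewrite tnth_mktuple.
  by apply: eq_from_tnth => j; rewrite tnth_mktuple; apply: Fuw.
have -> : [set w | B [tuple t j w | j < c]] = \bigcup_(u in [set u | B u]) F u.
  apply/seteqP; split=> w /=.
    by move=> Bw; exists [tuple t j w | j < c] => //; apply/FE.
  by move=> [u Bu] /FE ->.
rewrite measure_fin_bigcup; last 3 first.
- exact: finite_finset.
- by move=> u v _ _ [w [/FE <- /FE]].
- move=> u _; apply: fin_bigcap_measurable => [|j _]; last exact: t_meas.
  exact: finite_finset.
rewrite -(bigfs _ (index_enum_uniq _)) => [|u _]; last by rewrite mem_index_enum.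
rewrite -sumEFin; apply: eq_bigr => u _.
apply: etrans (t_indep (fun j => [set tnth u j])) _.
rewrite /sample_weight big_tuple -prodEFin.
by apply: eq_bigr => j _; apply: t_prob.
Qed.

Lemma sampling_matrix_gram (R : realType) (m n c : nat) (Q : 'M[R]_(m, n))
    (p : 'I_n -> R) (u : c.-tuple 'I_n)
    (A := Q *m sampling_matrix p (tnth u)) :
  A *m A^T =
    sample_gram (fun i => (Num.sqrt (c%:R * p i))^-1 *: col i Q) u.
Proof.
rewrite mulmxT_sum_col /sample_gram big_tuple; apply: eq_bigr => j _.
suff -> : col j A = (Num.sqrt (c%:R * p (tnth u j)))^-1 *: col (tnth u j) Q by [].
apply/colP => a; rewrite !mxE (bigD1 (tnth u j)) //= big1 => [|k /negPf kj].
  by rewrite mxE eqxx mul1r addr0 mulrC.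
by rewrite mxE kj mul0r mulr0.
Qed.

(** The hypothesis on the column norms says that the rescaled columns x i
    satisfy |x i|^2 <= L.  It also forces column i to vanish when p i = 0;
    this is why the mean of x x^T is exactly the identity divided by c. *)
Lemma condition_number_sampling (R : realType) (m n c : nat) (Q : 'M[R]_(m, n))
    (eps delta L : R) (p : 'I_n -> R)
    (d : measure_display) (T : measurableType d) (P : probability T R)
    (t : 'I_c -> T -> 'I_n) :
  (0 < m)%N -> (0 < c)%N -> Q *m Q^T = 1%:M ->
  0 < eps < 1 -> 0 < delta -> is_prob_vector p -> sampled_indices P p t ->
  0 < L -> (forall i, norm2 (col i Q) ^+ 2 <= c%:R * L * p i) ->
  c0 eps * L * ln (m%:R / delta) <= eps ^+ 2 ->
  ((1 - delta)%:E <=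
    P [set w : T |
        kappa_le (Q *m sampling_matrix p (fun j => t j w))
          (Num.sqrt (1 + eps) / Num.sqrt (1 - eps))])%E.
Proof.
move=> m_gt0 c_gt0 QQ eps01 delta_gt0 [p_ge0 p_sum1] t_sampled L_gt0 Q_le L_le.
have c_pos : 0 < c%:R :> R by rewrite ltr0n.
set b := Num.sqrt _ / _.
pose good (u : c.-tuple 'I_n) := `[< kappa_le (Q *m sampling_matrix p (tnth u)) b >].
have -> : [set w | kappa_le (Q *m sampling_matrix p (fun j => t j w)) b] =
    [set w | good [tuple t j w | j < c]].
  have tnthE w : tnth [tuple t j w | j < c] = (fun j => t j w).
    by apply/funext => j; rewrite tnth_mktuple.
  by apply/funext => w; rewrite /= /good asboolE tnthE.
rewrite (sampled_event_prob _ t_sampled) lee_fin.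
pose x i := (Num.sqrt (c%:R * p i))^-1 *: col i Q.
have xE i : x i *m (x i)^T = (c%:R * p i)^-1 *: (col i Q *m (col i Q)^T).
  rewrite /x linearZ /= -scalemxAl -scalemxAr scalerA -invfM -expr2.
  by rewrite sqr_sqrtr // mulr_ge0.
have trx i : \tr (x i *m (x i)^T) <= L.
  rewrite xE linearZ /= -norm2_sqr.
  have [p0|p_neq0] := eqVneq (p i) 0; first by rewrite p0 mulr0 invr0 mul0r ltW.
  have p_gt0 : 0 < p i by rewrite lt0r p_neq0 p_ge0.
  rewrite mulrC ler_pdivrMr; last by rewrite mulr_gt0.
  by rewrite mulrCA mulrA.
have meanx : \sum_i p i *: (x i *m (x i)^T) = (c%:R^-1)%:M.
  rewrite -scalemx1 -QQ mulmxT_sum_col scaler_sumr; apply: eq_bigr => i _.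
  rewrite xE scalerA; have [p0|p_neq0] := eqVneq (p i) 0.
    have col0 : col i Q *m (col i Q)^T = 0.
      rewrite (@mxtrace_mulT_eq0 _ _ _ (col i Q)) ?mul0mx //; apply/eqP.
      by rewrite -norm2_sqr eq_le sqr_ge0 andbT (le_trans (Q_le i)) // p0 mulr0.
    by rewrite col0 !scaler0.
  by congr (_ *: _); rewrite invfM mulrCA divff ?mulr1.
have bad_spec u : ~~ good u -> exists l1 l2, [/\ eigenvalue (sample_gram x u) l1,
     eigenvalue (sample_gram x u) l2 & l2 * (1 + eps) <= l1 * (1 - eps)].
  move=> /asboolPn bad; apply: contrapT => no_pair; apply: bad.
  apply: kappa_le_spectrum => // l1 l2; rewrite sampling_matrix_gram => l1G l2G.
  by rewrite ltNge; apply/negP => l21; apply: no_pair; exists l1, l2.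
have := sample_spectrum_tail c_gt0 p_ge0 p_sum1 L_gt0 trx meanx eps01 bad_spec.
have := sample_weight_sum1 p_sum1 c; rewrite (bigID good) /=.
have tail : m%:R * expR (- (eps ^+ 2 / (2 + 2 / 3 * eps) / L)) <= delta.
  have m_pos : 0 < m%:R :> R by rewrite ltr0n.
  have c0_gt0 : 0 < c0 eps by rewrite /c0; case/andP: eps01; lra.
  rewrite mulrC -ler_pdivlMr // -[delta / _]lnK ?posrE ?divr_gt0 // ler_expR.
  rewrite -[delta / _]invf_div lnV ?posrE ?divr_gt0 // lerN2.
  rewrite ler_pdivlMr // ler_pdivlMr // -/(c0 eps).
  by rewrite -mulrA mulrC (mulrC L).
lra.
Qed.

Theorem theorem6p3 (R : realType) (m n c : nat) (Q : 'M[R]_(m, n))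
    (eps delta : R) (p : 'I_n -> R)
    (d : measure_display) (T : measurableType d) (P : probability T R)
    (t : 'I_c -> T -> 'I_n)
    (m_gt0 : (0 < m)%N)
    (Q_orthonormal : Q *m Q^T = 1%:M)
    (c_range : (1 <= c <= n)%N)
    (eps_range : 0 < eps < 1)
    (delta_range : 0 < delta < 1)
    (p_prob : is_prob_vector p)
    (t_sampled : sampled_indices P p t)
    (sampling_mode :
      (exists beta : R,
        [/\ 0 < beta <= 1,
            forall j : 'I_n,
              beta * norm2 (col j Q) ^+ 2 / normF Q ^+ 2 <= p j
          & c0 eps * m%:R * (ln (m%:R / delta) / (beta * eps ^+ 2)) <= c%:R])
      \/
      ((forall j : 'I_n, p j = n%:R^-1) /\
       c0 eps * n%:R * coherence Q * (ln (m%:R / delta) / eps ^+ 2) <= c%:R)) :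
  ((1 - delta)%:E <=
    P [set w : T |
        kappa_le (Q *m sampling_matrix p (fun j => t j w))
          (Num.sqrt (1 + eps) / Num.sqrt (1 - eps))])%E.
Proof.
have [e0 e1] := andP eps_range; have [d0 d1] := andP delta_range.
have c_gt0 : (0 < c)%N by case/andP: c_range.
have n_gt0 : (0 < n)%N by case/andP: c_range => c1 /(leq_trans c1).
have c_pos : 0 < c%:R :> R by rewrite ltr0n.
have m_pos : 0 < m%:R :> R by rewrite ltr0n.
have n_pos : 0 < n%:R :> R by rewrite ltr0n.
have e2c_ge0 : 0 <= eps ^+ 2 / c%:R by rewrite divr_ge0 ?sqr_ge0.
have e2c : c%:R * (eps ^+ 2 / c%:R) = eps ^+ 2 by rewrite mulrC divfK ?gt_eqF.
case: sampling_mode => [[beta [/andP[beta_gt0 _] p_beta c_ge]]|[p_unif c_ge]].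
  apply: (@condition_number_sampling _ _ _ _ _ _ _ (m%:R / (beta * c%:R))) =>
    // [|i|].
  - by rewrite divr_gt0 ?mulr_gt0.
  - have := p_beta i; rewrite normF_sqr Q_orthonormal mxtrace1.
    rewrite ler_pdivrMr // -ler_pdivlMl // => /le_trans -> //.
    rewrite le_eqVlt; apply/orP; left; apply/eqP; field.
    by rewrite !lt0r_neq0.
  rewrite -e2c; apply: le_trans (ler_wpM2r e2c_ge0 c_ge).
  rewrite le_eqVlt; apply/orP; left; apply/eqP; field.
  by rewrite !lt0r_neq0.
have mu_gt0 := coherence_gt0 m_gt0 Q_orthonormal.
apply: (@condition_number_sampling _ _ _ _ _ _ _ (n%:R * coherence Q / c%:R)) =>
  // [|i|].
- by rewrite divr_gt0 ?mulr_gt0.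
- apply: (le_trans (norm2_le_coherence Q i)); rewrite p_unif.
  rewrite le_eqVlt; apply/orP; left; apply/eqP; field.
  by rewrite !lt0r_neq0.
rewrite -e2c; apply: le_trans (ler_wpM2r e2c_ge0 c_ge).
rewrite le_eqVlt; apply/orP; left; apply/eqP; field.
by rewrite !lt0r_neq0.
Qed.
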